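(* Let $L$ be a countable relational language and let $\varphi$ be a sentence of $\mathcal{L}_{\omega_1,\omega}(L)$. If there is a properly ergodic structure $\mu$ such that $\mu\models\varphi$, then $\varphi$ has continuum-many countable models up to isomorphism.
   Context: $\mathrm{Str}_L$ is the space of $L$-structures with domain $\mathbb{N}$, with the topology generated by the sets $\{M : M\models R(\overline{a})\}$ and $\{M: M\models\lnot R(\overline{a})\}$ ($R\in L$, $\overline a$ a tuple from $\mathbb{N}$). The logic action of $\mathrm{Sym}(\mathbb{N})$ on $\mathrm{Str}_L$ is by permuting the underlying set; its orbits are the isomorphism classes in $\mathrm{Str}_L$. A Borel probability measure $\mu$ on $\mathrm{Str}_L$ is invariant if $\mu(\sigma[X])=\mu(X)$ for all Borel $X$ and $\sigma\in\mathrm{Sym}(\mathbb{N})$. An invariant $\mu$ is ergodic if every Borel $X$ with $\mu(X\triangle\sigma[X])=0$ for all $\sigma\in \mathrm{Sym}(\mathbb{N})$ has $\mu(X)\in\{0,1\}$. An ergodic structure is an ergodic invariant probability measure on $\mathrm{Str}_L$; it is properly ergodic if it assigns measure $0$ to every orbit of the logic action. $\mu\models\varphi$ means $\mu(\{M\in\mathrm{Str}_L: M\models\varphi\})=1$. $\mathcal{L}_{\omega_1,\omega}$ extends first-order logic by conjunctions and disjunctions of countable families of formulas with a common finite set of free variables. *)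

(* Defs.v *)
From HB Require Import structures.
From mathcomp Require Import all_boot all_order all_algebra.
From mathcomp Require Import all_classical all_reals all_analysis.

Set Implicit Arguments.
Unset Strict Implicit.
Unset Printing Implicit Defensive.

Local Open Scope classical_set_scope.

Record language := Language {
  symbol : countType;
  arity : symbol -> nat
}.

Record structure (L : language) := Structure {
  domain : Type;
  domain_inhabited : inhabited domain;
  interp : forall r : symbol L, set ((arity r).-tuple domain)
}.

Definition isomorphic (L : language) (M N : structure L) : Prop :=
  exists2 f : domain M -> domain N, bijective f &
    forall (r : symbol L) (a : (arity r).-tuple (domain M)),
      interp a <-> interp (map_tuple f a).

(* [formula L n] is the type of L_{omega_1, omega}(L)-formulas whose free
   variables are among n variables indexed by 'I_n, so that the members of a
   conjunction or disjunction have a common finite set of free variables.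
   [Conj A F] and [Disj A F] only involve the F k with k in A, so every
   countable family, finite or empty ones included, is covered.
   A quantifier binds the variable of index 0. *)
Inductive formula (L : language) : nat -> Type :=
| Eq n (i j : 'I_n) : formula L n
| Rel n (r : symbol L) (t : (arity r).-tuple 'I_n) : formula L n
| Neg n (p : formula L n) : formula L n
| Conj n (A : set nat) (F : nat -> formula L n) : formula L n
| Disj n (A : set nat) (F : nat -> formula L n) : formula L n
| Forall n (p : formula L n.+1) : formula L n
| Exists n (p : formula L n.+1) : formula L n.

Definition sentence (L : language) := formula L 0.

Fixpoint satisfies (L : language) (M : structure L) (n : nat)
    (p : formula L n) : n.-tuple (domain M) -> Prop :=
  match p in formula _ n return n.-tuple (domain M) -> Prop with
  | Eq _ i j => fun v => tnth v i = tnth v j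
  | Rel _ r t => fun v => interp (map_tuple (tnth v) t)
  | Neg _ q => fun v => ~ satisfies q v
  | Conj _ A F => fun v => forall k, A k -> satisfies (F k) v
  | Disj _ A F => fun v => exists2 k, A k & satisfies (F k) v
  | Forall _ q => fun v => forall x, satisfies q [tuple of x :: v]
  | Exists _ q => fun v => exists x, satisfies q [tuple of x :: v]
  end.

Arguments satisfies {L} M {n} p v.

Definition models (L : language) (M : structure L) (p : sentence L) : Prop :=
  satisfies M p [tuple].

Definition Str (L : language) : Type :=
  forall r : symbol L, set ((arity r).-tuple nat).

Definition structure_of (L : language) (M : Str L) : structure L :=
  Structure (inhabits 0) M.

Definition subbasic_Str (L : language) : set (set (Str L)) :=
  [set U | exists (r : symbol L) (a : (arity r).-tuple nat),
     U = [set M | M r a] \/ U = [set M | ~ M r a]].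

HB.instance Definition _ (L : language) := gen_eqMixin (Str L).
HB.instance Definition _ (L : language) := gen_choiceMixin (Str L).
HB.instance Definition _ (L : language) :=
  isPointed.Build (Str L) (fun r => set0).
HB.instance Definition _ (L : language) :=
  isSubBaseTopological.Build (Str L) (@subbasic_Str L) id.

Definition borelStr (L : language) := g_sigma_algebraType (@open (Str L)).

(* For a permutation sigma, the relations of sigma . M are the images under
   sigma of the relations of M. *)
Definition logic_action (L : language) (sigma : nat -> nat) (M : Str L) :
    Str L :=
  fun r => map_tuple sigma @` M r.

Definition logic_orbit (L : language) (M : Str L) : set (Str L) :=
  [set N | exists2 sigma : nat -> nat, bijective sigma &
     N = logic_action sigma M].

Section ErgodicStructures.
Context (R : realType) (L : language).
Implicit Types mu : probability (borelStr L) R.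

Definition invariant_measure mu : Prop :=
  forall (sigma : nat -> nat) (X : set (borelStr L)),
    bijective sigma -> measurable X ->
    mu (logic_action sigma @` X) = mu X.

Definition ergodic mu : Prop :=
  forall X : set (borelStr L), measurable X ->
    (forall sigma : nat -> nat, bijective sigma ->
       mu (X `+` logic_action sigma @` X) = 0%E) ->
    mu X = 0%E \/ mu X = 1%E.

Definition ergodic_structure mu : Prop := invariant_measure mu /\ ergodic mu.

Definition properly_ergodic mu : Prop :=
  ergodic_structure mu /\ forall M : Str L, mu (logic_orbit M) = 0%E.

Definition measure_models mu (p : sentence L) : Prop :=
  mu [set M : Str L | models (structure_of M) p] = 1%E.

End ErgodicStructures.

Definition countable_models (L : language) (p : sentence L) :
    set (structure L) :=
  [set M | countable [set: domain M] /\ models M p].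

Definition iso_classes (L : language) (K : set (structure L)) :
    set (set (structure L)) :=
  (fun M => [set N | isomorphic M N]) @` K.

Definition continuum_many T (A : set T) : Prop := (A #= [set: set nat])%card.

(* Main.v *)
Require Import Defs.
From mathcomp Require Import finmap.
From mathcomp Require Import all_boot all_order all_algebra.
From mathcomp Require Import all_classical all_reals all_analysis.

Set Implicit Arguments.
Unset Strict Implicit.
Unset Printing Implicit Defensive.
Import Order.TTheory GRing.Theory Num.Theory.

Local Open Scope classical_set_scope.

(** If [phi] has fewer than continuum many countable models up to isomorphism,
then an ergodic structure almost surely satisfying [phi] concentrates on one
orbit.  The proof replaces formulas and Scott ranks by invariant Borel
relations: families [B a] of Borel sets of structures, indexed by finite
tuples [a], such that membership of [M] in [B a] only depends on the
isomorphism type of [(M, a)].  They form a sigma-algebra closed under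
quantification over one more entry of the tuple, which is all that a
back-and-forth argument needs.

Fix a tuple [c], and call a Borel set unsplit at [c] when no [B c] cuts it
into two pieces of positive measure.  There are two cases.

Either some set [K0] of positive measure contains no unsplit set of positive
measure.  Then positive subsets of [K0] can be split forever, and inner
regularity of [mu] together with compactness of [Str L] turns this into a map
from the Cantor space to models of [phi] in [K0], two distinct values of which
are always separated by some [B c] ([perfect_separation]).  If [f x] and [f y]
are both isomorphic to [N], and [c] is carried to the same tuple of [N] by the
two isomorphisms, then no invariant relation separates [f x] from [f y] at
[c]; so each isomorphism class is hit at most countably often.  A diagonal
argument ([countable_to_one_injection]) yields continuum many classes.

Or every set of positive measure contains an unsplit one, for every [c].  The
invariant envelope of an unsplit set is an atom among the invariant relations
([unsplit_complete_type]): it behaves like a complete type of positive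
measure.  By exhaustion countably many such atoms describe almost every tuple
([complete_type_cover]).  Having an extension of a given type is again an
invariant relation, hence is decided by each atom, so almost all structures
satisfy the same back-and-forth conditions ([generic_structures]).  By
ergodicity they agree on the type of the empty tuple, so they are all
isomorphic and form one orbit of measure one ([conull_orbit]).  This
contradicts proper ergodicity.

Conversely there are at most continuum many countable structures, since an
enumeration of the domain codes a structure by a set of natural numbers. *)

(** * Structures on the natural numbers and the logic action *)

Section Action.
Variable L : language.
Implicit Types (M N : Str L) (s t : nat -> nat).

Lemma map_tupleK (T U : Type) (f : T -> U) (g : U -> T) n :
  cancel f g -> cancel (@map_tuple n T U f) (map_tuple g).
Proof. by move=> fg a; apply/val_inj; rewrite /= mapK. Qed.

Lemma logic_actionE s t M (r : symbol L) (a : (arity r).-tuple nat) :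
  cancel s t -> cancel t s ->
  logic_action s M a = M r (map_tuple t a).
Proof.
move=> st ts; apply/propext; split.
- by move=> [b Mb <-]; rewrite map_tupleK.
- by move=> Mta; exists (map_tuple t a) => //; rewrite map_tupleK.
Qed.

Lemma Str_ext M N : (forall (r : symbol L) a, M r a <-> N r a) -> M = N.
Proof.
move=> MN; apply: functional_extensionality_dep => r.
by apply/seteqP; split=> a /MN.
Qed.

Lemma logic_actionK s t : cancel s t -> cancel t s ->
  cancel (@logic_action L s) (logic_action t).
Proof.
move=> st ts M; apply: Str_ext => r a.
by rewrite (logic_actionE _ _ ts st) (logic_actionE _ _ st ts) map_tupleK.
Qed.

Definition atomic_fact : countType := {r : symbol L & (arity r).-tuple nat}.

Definition holds M (l : atomic_fact) : Prop := M (tag l) (tagged l).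

(** The sets of structures satisfying finitely many prescribed literals are a
countable base of clopen sets; this is what makes countable unions suffice
below. *)
Definition cylinder (p : seq (atomic_fact * bool)) : set (Str L) :=
  [set M | forall lb, lb \in p -> `[< holds M lb.1 >] = lb.2].

Lemma open_cylinder U M : open U -> U M ->
  exists2 p, cylinder p M & cylinder p `<=` U.
Proof.
move=> oU UM.
have [F [sF VM VU]] : exists F : {fset set (Str L)},
    [/\ (forall X, X \in F -> subbasic_Str X), (forall X, X \in F -> X M) &
        forall N, (forall X, X \in F -> X N) -> U N].
  move: oU UM => [D sD <-] [V DV VM].
  have [F sF FV] := sD _ DV; exists F; split.
  - by move=> X /sF; rewrite inE.
  - by move: VM; rewrite -FV => VM X /VM.
  - by move=> N NF; exists V; [|rewrite /= -FV => X /NF].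
suff main : forall q : seq (set (Str L)), {subset q <= F} ->
    exists2 p, cylinder p M &
      forall N, cylinder p N -> forall X, X \in q -> X N.
  have [|p pM pF] := main (enum_fset F); first by [].
  by exists p => // N /pF /VU.
elim=> [|X q IH] qF; first by exists [::].
have [|p pM pF] := IH; first by move=> Y Yq; apply: qF; rewrite inE Yq orbT.
have XF : X \in F by apply: qF; rewrite inE eqxx.
(* a subbasic set containing [M] consists of the structures agreeing with [M] on
   one atomic fact *)
have [l Xl] : exists l : atomic_fact,
    X = [set N | `[< holds N l >] = `[< holds M l >]].
  have [r [a Xra]] := sF _ XF.
  exists (existT _ r a : {r : symbol L & (arity r).-tuple nat}).
  have XM := VM _ XF; case: Xra => Xra; rewrite Xra in XM *; apply/seteqP.
  - rewrite (asboolT XM); split=> N /=; first exact: asboolT.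
    by move/asboolP.
  - rewrite (asboolF XM); split=> N /=; first exact: asboolF.
    by move/negbT/asboolPn.
exists ((l, `[< holds M l >]) :: p).
- by move=> lb; rewrite inE => /predU1P[-> //|/pM].
- move=> N NP Y; rewrite inE => /predU1P[->|].
    by rewrite Xl; apply: (NP (l, _)); rewrite inE eqxx.
  by apply: pF => lb lbp; apply: NP; rewrite inE lbp orbT.
Qed.

Lemma open_subbase U : @subbasic_Str L U -> open U.
Proof.
move=> sU; exists [set U]; last by rewrite bigcup_set1.
move=> _ /= ->; exists [fset U]%fset.
  by move=> V /fset1P ->; exact: mem_set.
apply/seteqP; split=> x /=.
- by move/(_ U); apply; exact/fset1P.
- by move=> Ux V /fset1P ->.
Qed.

End Action.

(** * Borel sets of structures *)

Section Borel.
Variable L : language.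

Lemma measurable_open (U : set (Str L)) :
  open U -> measurable (U : set (borelStr L)).
Proof. exact: sub_sigma_algebra. Qed.

Lemma measurable_closed (C : set (Str L)) :
  closed C -> measurable (C : set (borelStr L)).
Proof.
move=> cC; rewrite -[C]setCK; apply: (@measurableC _ (borelStr L)).
exact: (measurable_open (closed_openC cC)).
Qed.

Lemma clopen_fact (l : atomic_fact L) (b : bool) :
  clopen [set M : Str L | `[< holds M l >] = b].
Proof.
have openT : open [set M : Str L | holds M l].
  by apply: open_subbase; exists (tag l), (tagged l); left.
have openF : open [set M : Str L | ~ holds M l].
  by apply: open_subbase; exists (tag l), (tagged l); right.
have closedT : closed [set M : Str L | holds M l].
  by rewrite -[[set M | _]]setCK; exact: (open_closedC openF).
have closedF : closed [set M : Str L | ~ holds M l].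
  exact: (open_closedC openT).
have -> : [set M : Str L | `[< holds M l >] = b] =
    if b then [set M : Str L | holds M l] else [set M : Str L | ~ holds M l].
  by case: b; apply/seteqP; split=> M /=; case: asboolP.
by case: b.
Qed.

Lemma cylinder_nil : cylinder [::] = [set: Str L].
Proof. by apply/seteqP; split. Qed.

Lemma cylinder_cons (lb : atomic_fact L * bool) p :
  cylinder (lb :: p) =
  [set M : Str L | `[< holds M lb.1 >] = lb.2] `&` cylinder p.
Proof.
apply/seteqP; split=> M.
- move=> Mp; split; first by apply: Mp; rewrite inE eqxx.
  by move=> lb' lb'p; apply: Mp; rewrite inE lb'p orbT.
- by move=> [Mlb Mp] lb'; rewrite inE => /predU1P[-> //|/Mp].
Qed.

Lemma clopen_cylinder (p : seq (atomic_fact L * bool)) : clopen (cylinder p).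
Proof.
elim: p => [|lb p [op cp]].
  by rewrite cylinder_nil; split; [exact: openT|exact: closedT].
have [ol cl] := clopen_fact lb.1 lb.2.
by rewrite cylinder_cons; split; [exact: openI|exact: closedI].
Qed.

Lemma open_bigcup_cylinder (U : set (Str L)) : open U ->
  U = \bigcup_(p in [set p | cylinder p `<=` U]) cylinder p.
Proof.
move=> oU; apply/seteqP; split=> M.
- by move=> /(open_cylinder oU)[p pM pU]; exists p.
- by move=> [p pU]; exact: pU.
Qed.

Lemma measurable_holds (l : atomic_fact L) :
  measurable ([set M | holds M l] : set (borelStr L)).
Proof.
apply: measurable_open; have [oT _] := clopen_fact l true.
rewrite (_ : [set M | holds M l] = [set M | `[< holds M l >] = true]) //.
by apply/seteqP; split=> M /= /asboolP.
Qed.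

Lemma image_action s t (X : set (Str L)) : cancel s t -> cancel t s ->
  logic_action s @` X = logic_action t @^-1` X.
Proof.
move=> st ts; apply/seteqP; split=> M /=.
- by move=> [N XN <-]; rewrite (logic_actionK st ts).
- by move=> XM; exists (logic_action t M) => //; rewrite (logic_actionK ts st).
Qed.

End Borel.

(** * Countable operations under a probability measure *)

Section FiniteMeasure.
Local Open Scope ereal_scope.
Context d (T : measurableType d) (R : realType) (mu : probability T R).

Lemma bigcup_unpickle (I : countType) (F : I -> set T) :
  \bigcup_i F i = \bigcup_n (if @unpickle I n is Some i then F i else set0).
Proof.
apply/seteqP; split=> x.
- by move=> [i _ Fix]; exists (pickle i) => //; rewrite pickleK.
- by move=> [n _]; case: (unpickle n) => // i Fix; exists i.
Qed.

Lemma measurable_bigcup_countType (I : countType) (F : I -> set T) :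
  (forall i, measurable (F i)) -> measurable (\bigcup_i F i).
Proof.
move=> mF; rewrite bigcup_unpickle; apply: bigcupT_measurable => n.
by case: (unpickle n).
Qed.

Lemma measurable_set_cst (P : Prop) : measurable ([set _ | P] : set T).
Proof.
have [p|np] := pselect P.
  by rewrite (_ : [set _ | _] = setT)//; apply/seteqP; split.
by rewrite (_ : [set _ | _] = set0)//; apply/seteqP; split.
Qed.

Lemma null_bigcup (I : countType) (F : I -> set T) :
  (forall i, measurable (F i)) -> (forall i, mu (F i) = 0) ->
  mu (\bigcup_i F i) = 0.
Proof.
move=> mF F0; rewrite bigcup_unpickle; apply: measure_negligible.
- by apply: bigcupT_measurable => n; case: (unpickle n).
- apply: negligible_bigcup => n; by apply/negligibleP; case: (unpickle n).
Qed.

Lemma null_setU (A B : set T) : measurable A -> measurable B ->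
  mu A = 0 -> mu B = 0 -> mu (A `|` B) = 0.
Proof. by move=> mA mB A0 B0; rewrite measureU0. Qed.

(** Continuity from above at the empty set, for the tails of the union. *)
Lemma finite_approximation (F : nat -> set T) (e : R) :
  (0 < e)%R -> (forall n, measurable (F n)) ->
  exists n, mu ((\bigcup_i F i) `\` (\big[setU/set0]_(i < n) F i)) < e%:E.
Proof.
move=> e0 mF; pose G n := (\bigcup_i F i) `\` (\big[setU/set0]_(i < n) F i).
have mG n : measurable (G n).
  by apply: measurableD; [exact: bigcupT_measurable|exact: bigsetU_measurable].
have G0 : \bigcap_n G n = set0.
  apply/seteqP; split=> // x Gx; have [[i _ Fix] _] := Gx 0%N I.
  by have [_] := Gx i.+1 I; apply; rewrite -bigcup_mkord; exists i => /=.
have := @nonincreasing_cvg_mu _ _ _ mu G.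
rewrite G0 measure0 => /(_ _ mG measurable0).
have Gn : {homo G : n m / (n <= m)%N >-> (m <= n)%O}.
  move=> n m nm; apply/subsetPset => x [Fx nFx]; split=> //.
  apply: contra_not nFx; rewrite -!bigcup_mkord => -[i /= im Fix].
  by exists i => //=; exact: leq_trans im nm.
have PG : mu (G 0%N) < +oo by rewrite ltey_eq fin_num_measure.
move=> /(_ PG Gn) cG.
have /cG[n _ /(_ n (leqnn n))] : nbhs (0 : \bar R) [set y | y < e%:E].
  by apply: open_nbhs_nbhs; split; [exact: open_ereal_lt_ereal|rewrite /= lte_fin].
by exists n.
Qed.

Lemma geometric_subadditivity (F : nat -> set T) (e : R) :
  (0 <= e)%R -> (forall n, measurable (F n)) ->
  (forall n, mu (F n) <= (e / (2 ^ n.+1)%:R)%:E) -> mu (\bigcup_i F i) <= e%:E.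
Proof.
move=> e0 mF PF.
have := @measure_sigma_subadditive _ _ _ mu (\bigcup_i F i) F mF.
move=> /(_ (bigcupT_measurable _ mF) (@subset_refl _ _)) /le_trans; apply.
have := @epsilon_trick R (fun=> 0) e xpredT (fun=> lexx 0) e0.
rewrite [X in (X + e%:E)%E]eseries0// add0e; apply: le_trans.
apply: lee_nneseries => // n _.
by rewrite add0e; exact: PF.
Qed.

(** A countably closed family contains a set of maximal measure, and that set
absorbs every other member up to a null set.  This is the only source of
maximal objects in the proof: it produces both the atoms of the invariant
relations and a countable family of atoms of full measure. *)
Lemma exhaustion (S : set (set T)) :
  S !=set0 -> S `<=` measurable ->
  (forall F : nat -> set T, (forall n, S (F n)) -> S (\bigcup_n F n)) ->
  exists2 F, S F & forall G, S G -> mu (G `\` F) = 0.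
Proof.
move=> [S0 SS0] mS SU.
pose s := ereal_sup (mu @` S).
have s1 : s <= 1.
  by apply: ub_ereal_sup => _ [F SF <-]; apply: probability_le1; exact: mS.
have s0 : 0 <= s.
  by apply: (le_trans (measure_ge0 mu S0)); apply: ereal_sup_ubound; exists S0.
have fs : s \is a fin_num by rewrite ge0_fin_numE// (le_lt_trans s1)// ltry.
have /choice[F FP] (n : nat) : exists F, S F /\ s - (n.+1%:R^-1)%:E < mu F.
  have n0 : (0 < n.+1%:R^-1 :> R)%R by rewrite invr_gt0 ltr0n.
  by have [_ [G SG <-] Gs] := ub_ereal_sup_adherent n0 fs; exists G.
have SF : S (\bigcup_n F n) by apply: SU => n; have [] := FP n.
exists (\bigcup_n F n) => // G SG.
have mF := mS _ SF; have mG := mS _ SG.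
have sF : s <= mu (\bigcup_n F n).
  apply/lee_addgt0Pr => e e0.
  have [n ne] : exists n : nat, (n.+1%:R^-1 <= e)%R.
    have [n _ /(_ n (leqnn n))/ltW] := near_infty_natSinv_lt (PosNum e0).
    by exists n.
  rewrite -leeBlDr//; apply: (le_trans (y := s - (n.+1%:R^-1)%:E)).
    by rewrite leeB// lee_fin.
  have [_ /ltW/le_trans] := FP n; apply; apply: le_measure; rewrite ?inE//.
  - by apply: mS; have [] := FP n.
  - exact: bigcup_sup.
have SGF : S (G `|` \bigcup_n F n).
  rewrite (_ : _ `|` _ = \bigcup_n (if n is m.+1 then F m else G)).
    by apply: SU => -[//|n]; have [] := FP n.
  apply/seteqP; split=> x.
  - by move=> [Gx|[n _ Fx]]; [exists 0%N|exists n.+1].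
  - by move=> [[|n] _ Gx]; [left|right; exists n].
have : mu (G `|` \bigcup_n F n) <= mu (\bigcup_n F n).
  by apply: le_trans sF; apply: ereal_sup_ubound; exists (G `|` \bigcup_n F n).
have mGF : measurable (G `\` \bigcup_n F n) by exact: measurableD.
have -> : G `|` \bigcup_n F n = \bigcup_n F n `|` (G `\` \bigcup_n F n).
  apply/seteqP; split=> x; last by move=> [Fx|[Gx _]]; [right|left].
  by have [Fx|nFx] := pselect ((\bigcup_n F n) x); [left|move=> [Gx|//]; right].
rewrite measureU//; last by rewrite setDIK.
rewrite -[X in _ <= X]adde0 leeD2lE ?fin_num_measure// => GF0.
by apply/eqP; rewrite eq_le GF0 measure_ge0.
Qed.

End FiniteMeasure.

(** * Inner regularity by closed sets *)

Section Regularity.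
Variables (R : realType) (L : language) (mu : probability (borelStr L) R).
Local Open Scope ereal_scope.

Definition inner_regular (B : set (Str L)) := forall e : R, (0 < e)%R ->
  exists C : set (Str L), [/\ closed C, C `<=` B & mu (B `\` C) <= e%:E].

Lemma inner_regular_closed (C : set (Str L)) : closed C -> inner_regular C.
Proof.
by move=> cC e e0; exists C; split=> //; rewrite setDv measure0 lee_fin ltW.
Qed.

(** Half of [e] pays for approximating each [B n], the other half for passing
to a finite, hence closed, union of the approximations. *)
Lemma inner_regular_bigcup (B : nat -> set (Str L)) :
  (forall n, measurable (B n : set (borelStr L))) ->
  (forall n, inner_regular (B n)) -> inner_regular (\bigcup_n B n).
Proof.
move=> mB rB e e0.
have e2 : (0 < e / 2)%R by rewrite divr_gt0.
have en n : (0 < e / 2 / (2 ^ n.+1)%:R)%R by rewrite divr_gt0// ltr0n expn_gt0.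
have /choice[C /all_and3[cC CB mC]] n := rB n _ (en n).
have mCn n : measurable (C n : set (borelStr L)) by exact: measurable_closed.
have [n Cn] := finite_approximation mu e2 mCn.
exists (\big[setU/set0]_(i < n) C i); split.
- by apply: closed_bigsetU => i _.
- by rewrite -bigcup_mkord => M [i _ CM]; exists i => //; exact: CB.
have -> : e = (e / 2 + e / 2)%R by rewrite -splitr.
rewrite EFinD.
have mBC : measurable (\bigcup_i (B i `\` C i) : set (borelStr L)).
  by apply: bigcupT_measurable => i; exact: measurableD.
pose tail : set (borelStr L) :=
  \bigcup_i C i `\` \big[setU/set0]_(i < n) C i.
have mtail : measurable tail.
  by apply: measurableD; [exact: bigcupT_measurable|exact: bigsetU_measurable].
apply: (@le_trans _ _ (mu (\bigcup_i (B i `\` C i) `|` tail))).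
  apply: le_measure; rewrite ?inE.
  - by apply: measurableD; [exact: bigcupT_measurable|exact: bigsetU_measurable].
  - exact: measurableU.
  - move=> M [[i _ BM] nCM]; have [CM|nCiM] := pselect (C i M).
      by right; split=> //; exists i.
    by left; exists i.
apply: le_trans (measureU2 _ _ _) _ => //; apply: leeD; last exact: ltW.
apply: geometric_subadditivity => //; first exact: ltW.
by move=> i; exact: measurableD.
Qed.

Lemma inner_regular_bigcap (B : nat -> set (Str L)) :
  (forall n, measurable (B n : set (borelStr L))) ->
  (forall n, inner_regular (B n)) -> inner_regular (\bigcap_n B n).
Proof.
move=> mB rB e e0.
have en n : (0 < e / (2 ^ n.+1)%:R)%R by rewrite divr_gt0// ltr0n expn_gt0.
have /choice[C /all_and3[cC CB mC]] n := rB n _ (en n).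
have mCn n : measurable (C n : set (borelStr L)) by exact: measurable_closed.
exists (\bigcap_i C i); split.
- by apply: closed_bigI => i _.
- by move=> M CM i _; exact/CB/CM.
apply: (@le_trans _ _ (mu (\bigcup_i (B i `\` C i)))).
  apply: le_measure; rewrite ?inE.
  - by apply: measurableD; exact: bigcapT_measurable.
  - by apply: bigcupT_measurable => i; exact: measurableD.
  - move=> M [BM nCM]; apply: contrapT => nBC; apply: nCM => i _.
    apply: contrapT => nCi; apply: nBC; exists i => //; split=> //; exact: BM.
apply: geometric_subadditivity => //; first exact: ltW.
by move=> i; exact: measurableD.
Qed.

(** Sets that are inner regular together with their complement form a
sigma-algebra, and open sets belong to it as countable unions of clopen
cylinders. *)
Lemma borel_inner_regular (B : set (Str L)) :
  measurable (B : set (borelStr L)) -> inner_regular B.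
Proof.
move=> mB.
suff : [/\ measurable (B : set (borelStr L)), inner_regular B &
  inner_regular (~` B)] by case.
move: B mB; apply: smallest_sub; first split.
- split=> //; first by apply: inner_regular_closed; exact: closed0.
  by rewrite setC0; apply: inner_regular_closed; exact: closedT.
- move=> A [mA rA rAC]; rewrite setTD; split=> //; last by rewrite setCK.
  exact: measurableC.
- move=> A /all_and3[mA rA rAC]; split.
  + exact: bigcupT_measurable.
  + exact: inner_regular_bigcup.
  + rewrite setC_bigcup; apply: inner_regular_bigcap => // n.
    exact: measurableC.
- move=> U oU; split; first exact: measurable_open.
  + rewrite (open_bigcup_cylinder oU).
    pose F n : set (Str L) :=
      if @unpickle (seq (atomic_fact L * bool)) n is Some p then
      (if `[< cylinder p `<=` U >] then cylinder p else set0) else set0.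
    have cF n : closed (F n).
      rewrite /F; case: (unpickle n) => [p|]; last exact: closed0.
      case: ifP => _; last exact: closed0.
      by have [_] := clopen_cylinder p.
    rewrite (_ : \bigcup_(p in _) _ = \bigcup_n F n).
      apply: inner_regular_bigcup => n; first exact: measurable_closed.
      exact: inner_regular_closed.
    apply/seteqP; split=> M.
    * by move=> [p pU pM]; exists (pickle p) => //; rewrite /F pickleK asboolT.
    * move=> [n _]; rewrite /F; case: (unpickle n) => // p.
      case: asboolP => // pU pM.
      by exists p.
  + by apply: inner_regular_closed; exact: open_closedC.
Qed.

Lemma positive_closed_subset (B : set (Str L)) :
  measurable (B : set (borelStr L)) -> mu B != 0 ->
  exists C : set (Str L), [/\ closed C, C `<=` B & mu C != 0].
Proof.
move=> mB B0.
have muB : 0 < mu B by rewrite lt0e B0 measure_ge0.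
have fB : mu B \is a fin_num by exact: fin_num_measure.
have e0 : (0 < fine (mu B) / 2)%R.
  by rewrite divr_gt0// fine_gt0// muB ltey_eq fB.
have [C [cC CB BC]] := borel_inner_regular mB e0.
exists C; split=> //; apply/eqP => C0.
have mC : measurable (C : set (borelStr L)) by exact: measurable_closed.
have : mu B <= (fine (mu B) / 2)%:E.
  apply: le_trans BC; rewrite measureD ?ltey_eq ?fB//.
  by rewrite setIidr// [X in _ - X](_ : _ = 0) ?sube0.
rewrite leNgt => /negP; apply.
rewrite -[X in _ < X]fineK// lte_fin ltr_pdivrMr// mulr_natr mulr2n ltrDl.
by rewrite fine_gt0// muB ltey_eq fB.
Qed.

End Regularity.

(** * A perfect set of separated structures *)

Section PerfectScheme.
Variables (R : realType) (L : language) (mu : probability (borelStr L) R).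
Local Open Scope ereal_scope.

(** Compactness of [Str L].  An ultrafilter containing all the [C n] decides
every atomic fact; the structure [M] made of the facts it accepts is its
limit. *)
Lemma nested_closed_nonempty (C : nat -> set (Str L)) :
  (forall n, closed (C n)) -> (forall n, C n.+1 `<=` C n) ->
  (forall n, C n !=set0) -> \bigcap_n C n !=set0.
Proof.
move=> cC CS C0.
have Cle m n : (m <= n)%N -> C n `<=` C m.
  move=> /subnK <-; elim: (n - m)%N => // k IH; exact: (subset_trans (CS _) IH).
pose F : set_system (Str L) := [set A | exists n, C n `<=` A].
have PF : ProperFilter F.
  split; first by move=> [n Cn]; have [M /Cn] := C0 n.
  split; first by exists 0%N.
  - move=> A B [m mA] [n nB]; exists (maxn m n) => M CM; split.
      by apply/mA/(Cle _ (maxn m n)); rewrite ?leq_maxl.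
    by apply/nB/(Cle _ (maxn m n)); rewrite ?leq_maxr.
  - by move=> A B AB [n nA]; exists n; exact: subset_trans AB.
have [G [UG FG]] := ultraFilterLemma PF.
pose M : Str L := fun r => [set a | G [set N : Str L | N r a]].
have GM (p : seq (atomic_fact L * bool)) : cylinder p M -> G (cylinder p).
  elim: p => [|lb p IH]; first by rewrite cylinder_nil => _; exact: filterT.
  rewrite cylinder_cons => -[Mlb Mp]; apply: filterI; last exact: IH.
  have [GT|GF] := in_ultra_setVsetC [set N : Str L | holds N lb.1] UG.
  - move: Mlb => /= <-; apply: filterS (GT) => N /= Nlb.
    by rewrite !asboolT//; exact: GT.
  - move: Mlb => /= <-; apply: filterS (GF) => N /= Nlb; rewrite !asboolF//.
    by move=> GT; have := filter_ex (filterI GT GF); case=> N' [].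
exists M => n _; apply: contrapT => CnM.
have [p pM pC] := open_cylinder (closed_openC (cC n)) CnM.
have GC : G (C n) by apply: FG; exists n.
by have [N [/pC]] := filter_ex (filterI (GM _ pM) GC).
Qed.

(** A Cantor scheme: a closed set of positive measure is split by a member of
[S], and both halves are shrunk to closed sets of positive measure.  Each
branch has a point by compactness, and two branches are separated by the
member of [S] used where they part. *)
Lemma perfect_separation (K0 : set (Str L)) (S : set (set (Str L))) :
  measurable (K0 : set (borelStr L)) -> mu K0 != 0 ->
  (forall B, S B -> measurable (B : set (borelStr L))) ->
  (forall K, measurable (K : set (borelStr L)) -> K `<=` K0 -> mu K != 0 ->
     exists B, [/\ S B, mu (K `&` B) != 0 & mu (K `\` B) != 0]) ->
  exists f : (nat -> bool) -> Str L, (forall x, K0 (f x)) /\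
    forall x y, x <> y -> exists2 B, S B & ~ (B (f x) <-> B (f y)).
Proof.
move=> mK0 K00 mS split0.
pose good (K : set (Str L)) := [/\ closed K, K `<=` K0 & mu K != 0].
have /choice[h hP] : forall K, exists Bc : set (Str L) * (bool -> set (Str L)),
    good K -> S Bc.1 /\ forall b,
      [/\ good (Bc.2 b), Bc.2 b `<=` K & forall M, Bc.2 b M -> (Bc.1 M <-> b)].
  move=> K; have [gK|ngK] := pselect (good K); last by exists (set0, fun=> set0).
  have [cK KK0 K1] := gK.
  have mK := measurable_closed cK.
  have [B [SB B1 B0]] := split0 K mK KK0 K1.
  have [C1 [cC1 CB1 C10]] : exists C : set (Str L),
      [/\ closed C, C `<=` K `&` B & mu C != 0].
    by apply: positive_closed_subset => //; apply: measurableI => //; exact: mS.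
  have [C2 [cC2 CB2 C20]] : exists C : set (Str L),
      [/\ closed C, C `<=` K `\` B & mu C != 0].
    by apply: positive_closed_subset => //; apply: measurableD => //; exact: mS.
  exists (B, fun b => if b then C1 else C2) => _; split=> // -[] /=; split.
  - by split=> // M /CB1[/KK0].
  - by move=> M /CB1[].
  - by move=> M /CB1[].
  - by split=> // M /CB2[/KK0].
  - by move=> M /CB2[].
  - by move=> M /CB2[].
have [K1 [cK1 K10 muK1]] := positive_closed_subset mK0 K00.
(* the closed set attached to the first [n] bits of the branch [x] *)
pose node (x : nat -> bool) := fix node n :=
  if n is m.+1 then (h (node m)).2 (x m) else K1.
have gnode x n : good (node x n).
  by elim: n => [|n IH] //=; have [_ /(_ (x n))[]] := hP _ IH.
have : forall x, exists M, forall n, node x n M.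
  move=> x; have [||n|M xM] := @nested_closed_nonempty (node x).
  - by move=> n; have [] := gnode x n.
  - by move=> n /=; have [_ /(_ (x n))[]] := hP _ (gnode x n).
  - apply/set0P/eqP => x0; have [_ _] := gnode x n.
    by rewrite x0 measure0 eqxx.
  - by exists M => n; exact: xM.
move=> /choice[f fP]; exists f; split; first by move=> x; exact/K10/(fP x 0%N).
move=> x y xy.
have ex : exists n, x n != y n.
  apply: contrapT => nex; apply: xy; apply/funext => n; apply/eqP.
  by apply: contra_notT nex => xyn; exists n.
have := ex_minnP ex; case=> n xyn nmin.
have xyE m : (m <= n)%N -> node x m = node y m.
  elim: m => //= m IH mn; rewrite IH; last exact: ltnW.
  congr (_ _ _); apply/eqP; apply: contraTT mn => /nmin.
  by rewrite -leqNgt.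
have [SB hn] := hP _ (gnode x n).
exists (h (node x n)).1 => // xyB.
have fx := fP x n.+1; have fy := fP y n.+1; rewrite /= -xyE// in fx fy.
have [_ _ /(_ _ fx) Bx] := hn (x n); have [_ _ /(_ _ fy) By] := hn (y n).
apply: (negP xyn); apply/eqP; apply/idP/idP => ?.
- exact/By/xyB/Bx.
- exact/Bx/xyB/By.
Qed.

End PerfectScheme.

(** * Invariant relations *)

Section InvariantRelations.
Variables (R : realType) (L : language) (mu : probability (borelStr L) R).
Local Open Scope ereal_scope.

(** Indexing by a tuple instead of using Borel sets fixed by the stabilizer of
that tuple lets the same relation be evaluated at tuples of different
structures.  By the Lopez-Escobar theorem these are the relations definable in
[L_{omega_1, omega}], separately for each length of the tuple. *)
Definition invariant_relation (B : seq nat -> set (borelStr L)) :=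
  (forall a, measurable (B a)) /\
  forall s, bijective s ->
    forall a M, B (map s a) (logic_action s M) <-> B a M.

Lemma invariant_setC B : invariant_relation B ->
  invariant_relation (fun a => ~` B a).
Proof.
move=> [mB sB]; split=> [a|s bs a M]; first exact: measurableC.
by split=> nB /(sB _ bs).
Qed.

Lemma invariant_bigcup (I : countType) (B : I -> seq nat -> set (borelStr L)) :
  (forall i, invariant_relation (B i)) ->
  invariant_relation (fun a => \bigcup_i B i a).
Proof.
move=> /all_and2[mB sB]; split=> [a|s bs a M].
  exact: measurable_bigcup_countType.
by split=> -[i _ /(sB _ _ bs)]; exists i.
Qed.

(** Intersecting with this relation, which says that [a] has the length of [c]
and the same equalities between entries, makes a property known at [c] decisive
at all tuples. *)
Lemma invariant_orbit (c : seq nat) :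
  invariant_relation (fun a => [set _ | exists2 s, bijective s & a = map s c]).
Proof.
split=> [a|s bs a M /=].
  exact: measurable_set_cst.
split=> -[u bu].
- have [t st ts] := bs => sa; exists (t \o u).
    exact: bij_comp (Bijective ts st) bu.
  by rewrite map_comp -sa mapK.
- by move=> ->; exists (s \o u); [exact: bij_comp|rewrite map_comp].
Qed.

Lemma invariant_setI B C : invariant_relation B -> invariant_relation C ->
  invariant_relation (fun a => B a `&` C a).
Proof.
move=> [mB sB] [mC sC]; split=> [a|s bs a M]; first exact: measurableI.
by split=> -[/(sB _ bs) ? /(sC _ bs) ?].
Qed.

(** The property of having an extension by one entry satisfying [B]: the
relation that drives the back-and-forth argument. *)
Lemma invariant_exists B : invariant_relation B ->
  invariant_relation (fun a => \bigcup_c B (rcons a c)).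
Proof.
move=> [mB sB]; split=> [a|s bs a M]; first exact: bigcupT_measurable.
have [t st ts] := bs; split=> -[c _].
- by rewrite -{1}(ts c) -map_rcons => /(sB _ bs) Bc; exists (t c).
- by move=> Bc; exists (s c) => //; rewrite -map_rcons; apply/(sB _ bs).
Qed.

(** The tuple stored in [l] is read as a list of positions in [a], and the bound
on these positions keeps the default value of [nth] from mattering. *)
Definition holds_at_entries (l : atomic_fact L) (a : seq nat) : set (borelStr L) :=
  [set M : Str L | (forall i, i \in (tagged l : seq nat) -> (i < size a)%N) /\
           M (tag l) (map_tuple (nth 0%N a) (tagged l))].

Lemma invariant_holds_at_entries l : invariant_relation (holds_at_entries l).
Proof.
case: l => r t; split=> [a|s bs a M]; rewrite /holds_at_entries /=.
  have [h|h] := pselect (forall i, i \in (t : seq nat) -> (i < size a)%N).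
    pose l : atomic_fact L := existT _ r (map_tuple (nth 0%N a) t).
    have := measurable_holds l.
    by congr (measurable _); apply/seteqP; split=> M //= -[].
  by rewrite (_ : [set _ | _] = set0)//; apply/seteqP; split=> M //= -[].
rewrite size_map; have [u su us] := bs.
rewrite (logic_actionE _ _ su us).
have E : (forall i, i \in (t : seq nat) -> (i < size a)%N) ->
    map_tuple u (map_tuple (nth 0%N (map s a)) t) = map_tuple (nth 0%N a) t.
  move=> ta; apply/val_inj => /=; rewrite -map_comp.
  apply/eq_in_map => i /ta ia /=.
  by rewrite (nth_map 0%N).
by split=> -[ta]; rewrite (E ta).
Qed.

Definition same_entry (ij : nat * nat) (a : seq nat) : set (borelStr L) :=
  [set _ | [&& ij.1 < size a, ij.2 < size a & nth 0 a ij.1 == nth 0 a ij.2]%N].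

Lemma invariant_same_entry ij : invariant_relation (same_entry ij).
Proof.
split=> [a|s bs a M]; rewrite /same_entry /=.
  exact: measurable_set_cst.
rewrite size_map.
have [ia|] //= := ltnP ij.1 (size a); have [ja|] //= := ltnP ij.2 (size a).
by rewrite !(nth_map 0%N)// (inj_eq (bij_inj bs)).
Qed.

Hypothesis muI : invariant_measure mu.

Lemma measure_invariant B s c : invariant_relation B -> bijective s ->
  mu (B (map s c)) = mu (B c).
Proof.
move=> [mB sB] bs; rewrite -(muI bs (mB c)); congr (mu _).
have [t st ts] := bs; rewrite (image_action _ st ts).
apply/seteqP; split=> M /=.
- by rewrite -{1}(logic_actionK ts st M) => /(sB _ bs).
- by move=> /(sB _ bs); rewrite (logic_actionK ts st M).
Qed.

(** * Atoms of the invariant relations *)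

Definition unsplit (c : seq nat) (K : set (borelStr L)) :=
  forall B, invariant_relation B -> mu (K `&` B c) = 0 \/ mu (K `\` B c) = 0.

(** The alternative is uniform in [e], so that a complete type answers each
question the same way at every tuple of every structure, up to null sets. *)
Definition complete_type (A : seq nat -> set (borelStr L)) :=
  invariant_relation A /\ forall B, invariant_relation B ->
    (forall e, mu (A e `&` B e) = 0) \/ (forall e, mu (A e `\` B e) = 0).

Lemma invariant_set0 : invariant_relation (fun=> set0).
Proof. by split=> // a; exact: measurable0. Qed.

(** By invariance of [mu] a relation concentrated on the tuples similar to [c]
has the same measure at all of these. *)
Lemma null_on_orbit B c : invariant_relation B ->
  (forall a M, B a M -> exists2 s, bijective s & a = map s c) ->
  mu (B c) = 0 -> forall a, mu (B a) = 0.
Proof.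
move=> iB Bc Bc0 a.
have [[s bs ->]|nac] := pselect (exists2 s, bijective s & a = map s c).
  by rewrite measure_invariant.
by rewrite (_ : B a = set0) ?measure0//; apply/seteqP; split=> // M /Bc /nac.
Qed.

(** Among the relations that miss [K] at [c] up to a null set, one, [D], is
maximal; its complement is the smallest invariant relation containing [K].  It
is an atom: for each [B], either [B] or its complement misses [K], hence is
absorbed by [D]. *)
Lemma unsplit_complete_type c K : measurable K -> unsplit c K ->
  exists2 A, complete_type A & mu (K `\` A c) = 0.
Proof.
move=> mK uK.
pose S := [set X | exists B,
  [/\ invariant_relation B, mu (K `&` B c) = 0 & X = B c]].
have [|||_ [D [iD KD ->]] maxD] := @exhaustion _ _ _ mu S.
- by exists set0, (fun=> set0); split=> //; rewrite setI0 measure0.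
- by move=> _ [B [[mB _] _ ->]].
- move=> F /choice[B BP].
  have iB n : invariant_relation (B n) by have [] := BP n.
  exists (fun a => \bigcup_n B n a); split; first exact: invariant_bigcup.
    rewrite setI_bigcupr; apply: null_bigcup => n; last by have [] := BP n.
    by apply: measurableI => //; have [] := iB n.
  by apply: eq_bigcupr => n _; have [] := BP n.
pose A a := ~` D a `&` [set _ | exists2 s, bijective s & a = map s c].
have iA : invariant_relation A.
  by apply: invariant_setI; [exact: invariant_setC|exact: invariant_orbit].
have [mA _] := iA; have [mD _] := iD.
exists A; last first.
  apply: (subset_measure0 _ _ _ KD); [exact: measurableD|exact: measurableI|].
  move=> M [KM nAM]; split=> //; apply: contrapT => nDM; apply: nAM; split=> //.
  by exists id; [exists id|rewrite map_id].
split=> // B iB; have [mB _] := iB; have iBC := invariant_setC iB.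
have [KB|KB] := uK B iB; [left|right].
- apply: (@null_on_orbit (fun a => A a `&` B a) c).
  + exact: invariant_setI.
  + by move=> a M [[]].
  + have : mu (B c `\` D c) = 0 by apply: maxD; exists B.
    apply: subset_measure0; [exact: measurableI|exact: measurableD|].
    by move=> M [[nD _] BM].
- apply: (@null_on_orbit (fun a => A a `&` ~` B a) c).
  + exact: invariant_setI.
  + by move=> a M [[]].
  + have : mu (~` B c `\` D c) = 0 by apply: maxD; exists (fun a => ~` B a).
    have mBC : measurable (~` B c) by exact: measurableC.
    apply: subset_measure0; [exact: measurableI|exact: measurableD|].
    by move=> M [[nD _] BM].
Qed.

Lemma complete_type_set0 : complete_type (fun=> set0).
Proof.
split; first exact: invariant_set0.
by move=> B _; left=> e; rewrite set0I measure0.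
Qed.

(** A countable union of complete types that is maximal at [c] has full
measure: an unsplit set of positive measure outside it would lie in a further
complete type. *)
Lemma complete_type_cover :
  (forall c K0, measurable K0 -> mu K0 != 0 ->
     exists K, [/\ measurable K, K `<=` K0, mu K != 0 & unsplit c K]) ->
  exists A : seq nat * nat -> seq nat -> set (borelStr L),
    (forall i, complete_type (A i)) /\ forall c, mu (~` \bigcup_i A i c) = 0.
Proof.
move=> H.
suff /choice[A AP] : forall c, exists A : nat -> seq nat -> set (borelStr L),
    (forall n, complete_type (A n)) /\ mu (~` \bigcup_n A n c) = 0.
  exists (fun i => A i.1 i.2); split=> [i|c]; first by have [] := AP i.1.
  have [cA] := AP c; apply: subset_measure0.
  - apply: measurableC; apply: measurable_bigcup_countType => i.
    by have [/(_ i.2)[[]]] := AP i.1.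
  - by apply: measurableC; apply: bigcupT_measurable => n; have [[]] := cA n.
  - by apply: subsetC => M [n _ AM]; exists (c, n).
move=> c.
pose S := [set X | exists A : nat -> seq nat -> set (borelStr L),
  (forall n, complete_type (A n)) /\ X = \bigcup_n A n c].
have mS : S `<=` measurable.
  by move=> _ [A [cA ->]]; apply: bigcupT_measurable => n; have [[]] := cA n.
have [|//||F SF maxF] := @exhaustion _ _ _ mu S.
- exists (\bigcup_(n : nat) set0), (fun _ _ => set0); split=> // n.
  exact: complete_type_set0.
- move=> F /choice[A AP].
  pose A' m := if @unpickle (nat * nat)%type m is Some kn
    then A kn.1 kn.2 else fun=> set0.
  exists A'; split.
    move=> m; rewrite /A'; case: (unpickle m) => [kn|]; last first.
      exact: complete_type_set0.
    by have [] := AP kn.1.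
  rewrite (_ : \bigcup_n A' n c = \bigcup_(i : nat * nat) A i.1 i.2 c).
    apply/seteqP; split=> M.
    + by move=> [k _]; have [_ ->] := AP k => -[n _ AM]; exists (k, n).
    + by move=> [[k n] _ AM]; exists k => //; have [_ ->] := AP k; exists n.
  rewrite [RHS]bigcup_unpickle; apply: eq_bigcupr => m _; rewrite /A'.
  by case: (unpickle m).
have mF := mS _ SF.
suff F0 : mu (~` F) = 0.
  by have [A [cA FA]] := SF; exists A; split=> //; rewrite -FA.
apply: contrapT => /eqP FC; have mFC : measurable (~` F) by exact: measurableC.
have [K [mK KF K0 uK]] := H c _ mFC FC.
have [A cA KA] := unsplit_complete_type mK uK.
have [[mA _] _] := cA.
have AF : mu (A c `\` F) = 0.
  apply: maxF; exists (fun=> A); split=> //.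
  by apply/seteqP; split=> M; [exists 0%N|case].
move/eqP : K0; apply.
have mKA : measurable (K `\` A c) by exact: measurableD.
have mAF : measurable (A c `\` F) by exact: measurableD.
apply: (subset_measure0 mK _ _ (null_setU mKA mAF KA AF)).
  exact: measurableU.
move=> M KM; have [AM|nAM] := pselect (A c M); [right|by left].
by split=> //; exact: KF.
Qed.

(** Quantifying over all tuples makes a countable list of almost sure
properties into an isomorphism invariant set of full measure. *)
Lemma conull_of_null_relations (I : countType)
    (X : I -> seq nat -> set (borelStr L)) :
  (forall i, invariant_relation (X i)) -> (forall i a, mu (X i a) = 0) ->
  let Omega := [set M | forall i a, ~ X i a M] in
  [/\ measurable Omega, mu Omega = 1 &
    forall s, bijective s -> forall M, Omega M -> Omega (logic_action s M)].
Proof.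
move=> iX X0 Omega.
have OmegaE : Omega = ~` \bigcup_(i : I * seq nat) X i.1 i.2.
  apply/seteqP; split=> M; first by move=> XM [[i a] _] /XM.
  by move=> XM i a XiM; apply: XM; exists (i, a).
have mX : measurable (\bigcup_(i : I * seq nat) X i.1 i.2).
  by apply: measurable_bigcup_countType => i; have [] := iX i.1.
split.
- by rewrite OmegaE; exact: measurableC.
- rewrite OmegaE probability_setC// null_bigcup ?sube0// => i.
  by have [] := iX i.1.
- move=> s bs M XM i a; have [t st ts] := bs; have [_ sX] := iX i.
  by rewrite -(mapK ts a) => /(sX _ bs); exact: XM.
Qed.

Hypothesis muE : ergodic mu.

(** Almost surely every tuple has one of the types [A i], and each [A i] decides
each [B j] in the same way everywhere.  Ergodicity selects a single type for
the empty tuple, because that type defines an invariant set. *)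
Lemma generic_structures (I J : countType)
    (A : I -> seq nat -> set (borelStr L))
    (B : J -> seq nat -> set (borelStr L)) :
  (forall i, complete_type (A i)) -> (forall a, mu (~` \bigcup_i A i a) = 0) ->
  (forall j, invariant_relation (B j)) ->
  exists Omega : set (borelStr L), [/\ measurable Omega, mu Omega = 1,
    forall s, bijective s -> forall M, Omega M -> Omega (logic_action s M),
    exists i, forall M, Omega M -> A i [::] M &
    forall M N, Omega M -> Omega N ->
      (forall a, exists i, A i a M) /\
      forall i a b, A i a M -> A i b N -> forall j, B j a M -> B j b N].
Proof.
move=> cA A1 iB.
have iA i : invariant_relation (A i) by have [] := cA i.
have mA i a : measurable (A i a) by have [] := iA i.
have [i0 Ai0] : exists i, mu (A i [::]) != 0.
  apply: contrapT => nA.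
  have := A1 [::]; rewrite probability_setC; last first.
    exact: measurable_bigcup_countType.
  rewrite null_bigcup// ?sube0 => [/eqP|i]; first by rewrite onee_eq0.
  by apply/eqP; apply: contra_notT nA => Ai; exists i.
have {}Ai0 : mu (A i0 [::]) = 1.
  have [s bs||//] := muE (mA i0 [::]); last by move/eqP; rewrite (negbTE Ai0).
  rewrite (_ : _ @` _ = A i0 [::]) ?setYK ?measure0//.
  have [t st ts] := bs; have [_ /(_ _ bs [::]) sA] := iA i0.
  rewrite (image_action _ st ts); apply/seteqP; split=> M /=.
  - by move=> /sA; rewrite (logic_actionK ts st).
  - by move=> AM; apply/sA; rewrite (logic_actionK ts st).
pose dec i j := `[< forall a, mu (A i a `\` B j a) = 0 >].
(* the null events to avoid: [Some (Some (i, j))] is a wrong answer of [A i] to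
   [B j], [Some None] a tuple without a type, and [None] a wrong type of the
   empty tuple *)
pose X (k : option (option (I * J))) a : set (borelStr L) := match k with
  | None => ~` A i0 [::]
  | Some None => ~` \bigcup_i A i a
  | Some (Some ij) =>
      A ij.1 a `&` (if dec ij.1 ij.2 then ~` B ij.2 a else B ij.2 a)
  end.
have iX k : invariant_relation (X k).
  case: k => [[[i j]|]|] /=.
  - apply: invariant_setI => //; case: (dec i j) => //; exact: invariant_setC.
  - exact/invariant_setC/invariant_bigcup.
  - split=> [a|s bs a M]; first exact: measurableC.
    by have [_ /(_ _ bs [::] M) sA] := iA i0; split=> nA /sA.
have X0 k a : mu (X k a) = 0.
  case: k => [[[i j]|]|] /=; last 2 first.
  - exact: A1.
  - by rewrite probability_setC// Ai0 subee.
  - rewrite /dec; case: asboolP => [/(_ a)//|ndec].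
    by have [_ /(_ _ (iB j))[/(_ a)|]] := cA i.
have [mO O1 OI] := conull_of_null_relations iX X0.
exists [set M | forall k a, ~ X k a M]; split=> //.
- by exists i0 => M /(_ None [::]) /= /contrapT.
- move=> M N OM ON; split=> [a|i a b AM AN j BM].
    by have /contrapT[i _ AM] := OM (Some None) a; exists i.
  apply: contrapT => nBN.
  have := OM (Some (Some (i, j))) a; have := ON (Some (Some (i, j))) b.
  by rewrite /=; case: (dec i j) => h1 h2; [apply: h1|apply: h2].
Qed.

End InvariantRelations.

(** * Back and forth *)

Section Isomorphism.
Variable L : language.

Lemma isomorphic_enumerations (M N : structure L)
    (g : nat -> domain M) (h : nat -> domain N) :
  (forall m, exists i, g i = m) -> (forall n, exists i, h i = n) ->
  (forall i j, g i = g j <-> h i = h j) ->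
  (forall (r : symbol L) (a : (arity r).-tuple nat),
     interp (map_tuple g a) <-> interp (map_tuple h a)) ->
  isomorphic M N.
Proof.
move=> /choice[g' gK] /choice[h' hK] gh ghr.
have hg i : h (g' (g i)) = h i by apply/gh; rewrite gK.
have gg i : g (h' (h i)) = g i by apply/gh; rewrite hK.
exists (h \o g').
  exists (g \o h') => [m|n] /=; first by rewrite gg gK.
  by rewrite hg hK.
move=> r a; have <- : map_tuple g (map_tuple g' a) = a by rewrite map_tupleK.
rewrite ghr.
suff -> : map_tuple (h \o g') (map_tuple g (map_tuple g' a)) =
  map_tuple h (map_tuple g' a) by [].
by apply/val_inj => /=; rewrite -!map_comp; apply/eq_map => m /=; rewrite gK.
Qed.

Lemma isomorphic_logic_action (M N : Str L) :
  isomorphic (structure_of M) (structure_of N) ->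
  exists2 s, bijective s & N = logic_action s M.
Proof.
move=> [s bs sMN]; exists s => //; have [t st ts] := bs.
apply: Str_ext => r a; rewrite (logic_actionE _ _ st ts).
rewrite -{1}(map_tupleK ts a); apply: iff_sym.
exact: (sMN r (map_tuple t a)).
Qed.

(** Stage [n] puts [n] into both tuples, so position [2n] of the first limit
enumeration and position [2n + 1] of the second have value [n]. *)
Lemma back_and_forth (M N : Str L) (E : seq nat -> seq nat -> Prop) :
  E [::] [::] ->
  (forall a b c, E a b -> exists d, E (rcons a c) (rcons b d)) ->
  (forall a b d, E a b -> exists c, E (rcons a c) (rcons b d)) ->
  (forall a b i j, E a b ->
     i < size a -> i < size b -> j < size a -> j < size b ->
     nth 0 a i = nth 0 a j <-> nth 0 b i = nth 0 b j) ->
  (forall a b (r : symbol L) (t : (arity r).-tuple nat), E a b ->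
     (forall i, i \in (t : seq nat) -> i < size a) ->
     (forall i, i \in (t : seq nat) -> i < size b) ->
     M r (map_tuple (nth 0 a) t) <-> N r (map_tuple (nth 0 b) t)) ->
  exists2 s, bijective s & N = logic_action s M.
Proof.
move=> E0 Eforth Eback Eeq Erel.
have /choice[step stepP] : forall kab : nat * (seq nat * seq nat),
  exists cd : nat * nat,
    E kab.2.1 kab.2.2 ->
    E (rcons (rcons kab.2.1 kab.1) cd.1) (rcons (rcons kab.2.2 cd.2) kab.1).
  move=> [k [a b]] /=; have [Eab|nE] := pselect (E a b); last by exists (0, 0).
  have [d Ed] := Eforth a b k Eab; have [c Ec] := Eback _ _ k Ed.
  by exists (c, d).
pose P := fix P n : seq nat * seq nat := if n is k.+1 then
  let cd := step (k, P k) in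
  (rcons (rcons (P k).1 k) cd.1, rcons (rcons (P k).2 cd.2) k) else ([::], [::]).
have EP n : E (P n).1 (P n).2.
  by elim: n => //= n IH; exact: (stepP (n, P n)).
have size1 n : size (P n).1 = n.*2.
  by elim: n => //= n IH; rewrite !size_rcons IH doubleS.
have size2 n : size (P n).2 = n.*2.
  by elim: n => //= n IH; rewrite !size_rcons IH doubleS.
have nthP n m i : n <= m -> i < n.*2 ->
    nth 0 (P m).1 i = nth 0 (P n).1 i /\ nth 0 (P m).2 i = nth 0 (P n).2 i.
  move=> /subnK <- ni; elim: (m - n) => // k [IH1 IH2] /=.
  have ki : i < (k + n).*2 by rewrite (leq_trans ni)// leq_double leq_addl.
  by rewrite !nth_rcons !size_rcons size1 size2 ki ltnS (ltnW ki) IH1 IH2.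
pose u i := nth 0 (P i.+1).1 i; pose v i := nth 0 (P i.+1).2 i.
have lt_double i : i < i.+1.*2 by rewrite doubleS ltnS -addnn leqW// leq_addr.
have uvE n i : i < n -> nth 0 (P n).1 i = u i /\ nth 0 (P n).2 i = v i.
  by move=> ni; exact: nthP.
have le_double k : k.+1 <= k.*2.+1 by rewrite ltnS -addnn leq_addr.
have uE k : u k.*2 = k.
  rewrite /u; have [||-> _] := @nthP k.+1 k.*2.+1 k.*2;
    [exact: le_double|by rewrite doubleS|].
  by rewrite /= !nth_rcons !size_rcons size1 ltnS leqnn ltnn eqxx.
have vE k : v k.*2.+1 = k.
  rewrite /v; have [||_ ->] := @nthP k.+1 k.*2.+2 k.*2.+1;
    [exact/leqW/le_double|by rewrite doubleS|].
  by rewrite /= !nth_rcons !size_rcons size2 ltnn eqxx.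
apply: isomorphic_logic_action.
apply: (@isomorphic_enumerations (structure_of M) (structure_of N) u v).
- by move=> k; exists k.*2.
- by move=> k; exists k.*2.+1.
- move=> i j; pose n := (maxn i j).+1.
  have il : i < n by rewrite ltnS leq_maxl.
  have jl : j < n by rewrite ltnS leq_maxr.
  have [<- <-] := uvE n i il; have [<- <-] := uvE n j jl.
  have nn : n <= n.*2 by rewrite -addnn leq_addr.
  by apply: Eeq; rewrite ?size1 ?size2// (leq_trans _ nn).
- move=> r t; pose n := (\max_(i <- (t : seq nat)) i).+1.
  have tn i : i \in (t : seq nat) -> i < n.
    by move=> it; rewrite ltnS; apply: (leq_bigmax_seq (F := id)).
  have nn : n <= n.*2 by rewrite -addnn leq_addr.
  have -> : map_tuple u t = map_tuple (nth 0 (P n).1) t.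
    by apply/val_inj/eq_in_map => i /tn /uvE[].
  have -> : map_tuple v t = map_tuple (nth 0 (P n).2) t.
    by apply/val_inj/eq_in_map => i /tn /uvE[].
  by apply: Erel => // i /tn; rewrite ?size1 ?size2 => /leq_trans; apply.
Qed.

End Isomorphism.

(** * An orbit of full measure *)

Section GenericOrbit.
Variables (R : realType) (L : language) (mu : probability (borelStr L) R).
Local Open Scope ereal_scope.

Lemma measurable_satisfies n (p : formula L n) (v : n.-tuple nat) :
  measurable ([set M : Str L | satisfies (structure_of M) p v]
    : set (borelStr L)).
Proof.
elim: p v => {n} /=.
- by move=> n i j v; exact: measurable_set_cst.
- move=> n r t v.
  exact: (measurable_holds (existT _ r (map_tuple (tnth v) t) : atomic_fact L)).
- by move=> n p IH v; exact: measurableC (IH v).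
- move=> n A F IH v.
  rewrite (_ : [set M | _] =
      \bigcap_(k in A) [set M | satisfies (structure_of M) (F k) v]).
    by apply: bigcap_measurableType => k _; exact: IH.
  by [].
- move=> n A F IH v.
  rewrite (_ : [set M | _] =
      \bigcup_(k in A) [set M | satisfies (structure_of M) (F k) v]).
    by apply: bigcup_measurable => k _; exact: IH.
  by [].
- move=> n p IH v.
  rewrite (_ : [set M | _] =
      \bigcap_x [set M | satisfies (structure_of M) p [tuple of x :: v]]).
    by apply: bigcapT_measurable => x; exact: IH.
  by apply/seteqP; split=> M h x; [move=> _|]; exact: h.
- move=> n p IH v.
  rewrite (_ : [set M | _] =
      \bigcup_x [set M | satisfies (structure_of M) p [tuple of x :: v]]).
    by apply: bigcupT_measurable => x; exact: IH.
  by apply/seteqP; split=> M; [move=> [x]|move=> [x _]]; exists x.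
Qed.

(** Two structures in the generic set are related tuple by tuple through their
common types.  An extension of a tuple realizes some type [A i]; the existence
of an extension of type [A i] is decided by the type of the tuple, so it
transfers to the other structure.  The generic set is itself the orbit, which
gives the measurability of the latter. *)
Lemma conull_orbit : ergodic_structure mu ->
  (forall c K0, measurable K0 -> mu K0 != 0 ->
     exists K, [/\ measurable K, K `<=` K0, mu K != 0 & unsplit mu c K]) ->
  exists M : Str L, mu (logic_orbit M) = 1.
Proof.
move=> [muI muE] /(complete_type_cover muI)[A [cA A1]].
pose J : countType := (seq nat * nat + (atomic_fact L + nat * nat))%type.
pose B (j : J) := match j with
  | inl i => fun a => \bigcup_c A i (rcons a c)
  | inr (inl l) => holds_at_entries l
  | inr (inr ij) => @same_entry L ij
  end.
have iB j : invariant_relation (B j).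
  case: j => [i|[l|ij]] /=.
  - by apply: invariant_exists; have [] := cA i.
  - exact: invariant_holds_at_entries.
  - exact: invariant_same_entry.
have [G [mO O1 OI [i0 Oi0] OP]] := generic_structures muE cA A1 iB.
have [M OM] : exists M, G M.
  apply: contrapT => nO.
  have O0 : G = set0 by apply/seteqP; split=> // M OM; case: nO; exists M.
  move: O1; rewrite O0 measure0 => /esym/eqP.
  by rewrite onee_eq0.
exists M; rewrite (_ : logic_orbit M = G)//.
apply/seteqP; split=> N; first by move=> [s bs ->]; exact: OI.
move=> ON.
have [Mtype MN] := OP M N OM ON; have [Ntype NM] := OP N M ON OM.
pose E a b := exists i, A i a M /\ A i b N.
have transfer a b j : E a b -> B j a M <-> B j b N.
  by move=> [i [AM AN]]; split; [exact: (MN i)|exact: (NM i)].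
apply: (@back_and_forth L M N E).
- by exists i0; split; exact: Oi0.
- move=> a b c Eab; have [i AM] := Mtype (rcons a c).
  have /(transfer a b (inl i) Eab)[d _ AN] : B (inl i) a M by exists c.
  by exists d, i.
- move=> a b d Eab; have [i AN] := Ntype (rcons b d).
  have /(transfer a b (inl i) Eab)[c _ AM] : B (inl i) b N by exists d.
  by exists c, i.
- move=> a b i j Eab ia ib ja jb.
  have := transfer a b (inr (inr (i, j))) Eab.
  rewrite /= /same_entry /= ia ib ja jb /= => -[ab ba].
  by split=> /eqP; [move/ab|move/ba]; move/eqP.
- move=> a b r t Eab ta tb.
  have [ab ba] := transfer a b (inr (inl (existT _ r t))) Eab.
  by split=> h; [have [] := ab (conj ta h)|have [] := ba (conj tb h)].
Qed.

End GenericOrbit.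

(** * Counting isomorphism classes *)

Section Cardinality.

(** Fibres of [g] cut the Cantor space into countably many pieces, and seeing
the Cantor space as a countable power of itself, one piece must project onto
the corresponding factor: otherwise a point omitted from each projection gives
a point outside all pieces.  A section of that projection is injective after
composition with [F]. *)
Lemma countable_to_one_injection T (N : countType) (F : (nat -> bool) -> T)
    (g : (nat -> bool) -> N) :
  (forall x y, F x = F y -> g x = g y -> x = y) ->
  exists h : set nat -> T, injective h /\ forall X, exists x, h X = F x.
Proof.
move=> Fg.
pose row (n : nat) (x : nat -> bool) (k : nat) := x (pickle (n, k)).
have [n nP] : exists n, forall y, exists x, pickle (g x) = n /\ row n x = y.
  apply: contrapT => nex.
  have /choice[y yP] n : exists y, forall x, pickle (g x) = n -> row n x <> y.
    apply: contrapT => ny; apply: nex; exists n => y; apply: contrapT => nxy.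
    by apply: ny; exists y => x gx xy; apply: nxy; exists x.
  pose x m :=
    if @unpickle (nat * nat)%type m is Some nk then y nk.1 nk.2 else false.
  apply: (yP (pickle (g x)) x) => //.
  by apply/funext => k; rewrite /row /x pickleK.
have [h hP] := choice nP.
exists (fun X => F (h (fun k => `[< X k >]))); split; last by move=> X; eexists.
move=> X Y /= XY.
have [gX rX] := hP (fun k => `[< X k >]).
have [gY rY] := hP (fun k => `[< Y k >]).
have hXY := Fg _ _ XY (pcan_inj pickleK (etrans gX (esym gY))).
have XYk : (fun k => `[< X k >]) = (fun k => `[< Y k >]) by rewrite -rX -rY hXY.
apply/funext => k; apply/propext; apply: asbool_eq_equiv.
exact: (congr1 (fun x => x k) XYk).
Qed.

Variable L : language.
Implicit Types M N : structure L.

Lemma isomorphic_refl M : isomorphic M M.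
Proof.
exists id; first by exists id.
by move=> r a; have -> : map_tuple id a = a by apply/val_inj; rewrite /= map_id.
Qed.

Lemma isomorphic_sym M N : isomorphic M N -> isomorphic N M.
Proof.
move=> [f [g fg gf] fM]; exists g; first by exists f.
by move=> r a; apply: iff_sym; rewrite -{2}(map_tupleK gf a).
Qed.

Lemma isomorphic_trans M N P :
  isomorphic M N -> isomorphic N P -> isomorphic M P.
Proof.
move=> [f bf fM] [g bg gN]; exists (g \o f); first exact: bij_comp.
move=> r a; rewrite fM gN.
suff -> : map_tuple g (map_tuple f a) = map_tuple (g \o f) a by [].
by apply/val_inj; rewrite /= -map_comp.
Qed.

Lemma iso_class_eq M N : isomorphic M N ->
  [set P | isomorphic M P] = [set P | isomorphic N P].
Proof.
move=> MN; apply/seteqP; split=> P /=.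
  exact/isomorphic_trans/isomorphic_sym.
exact: isomorphic_trans.
Qed.

Lemma countable_enumeration M : countable [set: domain M] ->
  exists g : nat -> domain M, forall m, exists i, g i = m.
Proof.
case: (domain_inhabited M) => m0 /countable_injP[f fI].
have /choice[g gP] : forall i, exists m, forall m', f m' = i -> m = m'.
  move=> i; have [[m fm]|nm] := pselect (exists m, f m = i).
    by exists m => m'; rewrite -fm => /esym/fI; apply; rewrite inE.
  by exists m0 => m' fm'; case: nm; exists m'.
by exists g => m; exists (f m); exact: gP.
Qed.

(** An enumeration, with repetitions for finite structures, codes a countable
structure by the set of equalities and atomic facts between indices. *)
Lemma iso_classes_le (K : set (structure L)) :
  (forall M, K M -> countable [set: domain M]) ->
  (iso_classes K #<= [set: set nat])%card.
Proof.
move=> cK.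
pose code M (g : nat -> domain M) : set nat := [set k |
  match @unpickle (nat * nat + atomic_fact L)%type k with
  | Some (inl ij) => g ij.1 = g ij.2
  | Some (inr l) => interp (map_tuple g (tagged l))
  | None => False
  end].
have code_iso M N (g : nat -> domain M) (h : nat -> domain N) :
    (forall m, exists i, g i = m) -> (forall n, exists i, h i = n) ->
    code M g = code N h -> isomorphic M N.
  move=> gS hS gh.
  have ghk k : code M g k <-> code N h k by rewrite gh.
  apply: (isomorphic_enumerations gS hS) => [i j|r a].
  - have := ghk (pickle (inl (i, j) : nat * nat + atomic_fact L)%type).
    by rewrite /code /= pickleK.
  - have := ghk (pickle (inr (existT _ r a) : nat * nat + atomic_fact L)%type).
    by rewrite /code /= pickleK.
have /choice[c cP] : forall C : set (structure L), exists X : set nat,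
    iso_classes K C -> exists M (g : nat -> domain M),
      [/\ C = [set N | isomorphic M N], forall m, exists i, g i = m &
          X = code M g].
  move=> C; have [[M KM <-]|nC] := pselect (iso_classes K C); last first.
    by exists set0.
  have [g gS] := countable_enumeration (cK M KM).
  by exists (code M g) => _; exists M, g.
have cI : {in iso_classes K &, injective c}.
  move=> C D; rewrite !inE => /cP[M [g [-> gS ->]]] /cP[N [h [-> hS ->]]] gh.
  exact/iso_class_eq/(code_iso _ _ g h).
have := inj_card_eq cI; rewrite card_eq_sym => /card_eqPle[le1 _].
by apply: card_le_trans le1 _; exact: subset_card_le.
Qed.

End Cardinality.

Theorem corollary4p8 (R : realType) (L : language) (phi : sentence L) :
  (exists mu : probability (borelStr L) R,
     properly_ergodic mu /\ measure_models mu phi) ->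
  continuum_many (iso_classes (countable_models phi)).
Proof.
move=> [mu [[muIE orbit0] phi1]].
apply: Cantor_Bernstein; first by apply: iso_classes_le => M [].
pose Mod : set (borelStr L) := [set M : Str L | models (structure_of M) phi].
have mMod : measurable Mod by exact: (measurable_satisfies phi [tuple]).
have [c [K0 [mK0 K00 splitK]]] : exists c K0, [/\ measurable K0, mu K0 != 0%E &
    forall K, measurable K -> K `<=` K0 -> mu K != 0%E -> ~ unsplit mu c K].
  apply: contrapT => nsplit.
  have [|M M1] := conull_orbit muIE; last first.
    by move: M1; rewrite orbit0 => /esym/eqP; rewrite onee_eq0.
  move=> c K0 mK0 K00; apply: contrapT => nK; apply: nsplit.
  by exists c, K0; split=> // K mK KK0 Kn0 uK; apply: nK; exists K.
have mKM : measurable (K0 `&` Mod) by exact: measurableI.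
have KM0 : mu (K0 `&` Mod) != 0%E.
  apply: contraNN K00 => /eqP KM; apply/eqP.
  have MC : mu (~` Mod) = 0%E by rewrite probability_setC// phi1 subee.
  apply: (subset_measure0 mK0 _ _ (null_setU mKM (measurableC mMod) KM MC)).
    by apply: measurableU => //; exact: measurableC.
  by move=> M KM'; have [MM|nMM] := pselect (Mod M); [left|right].
have [||||f [fK fsep]] := @perfect_separation _ _ mu (K0 `&` Mod)
    [set X | exists2 B, invariant_relation B & X = B c].
- exact: mKM.
- exact: KM0.
- by move=> _ [B [mB _] ->].
- move=> K mK KKM Kn0.
  have nuK := splitK K mK (fun M KM => (KKM M KM).1) Kn0.
  apply: contrapT => nB; apply: nuK => B iB.
  have [/eqP|KB] := eqVneq (mu (K `&` B c)) 0%E; first by move/eqP; left.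
  have [|KBC] := eqVneq (mu (K `\` B c)) 0%E; first by right.
  by case: nB; exists (B c); split=> //; exists B.
(* an isomorphism class [cls x] determines [x] up to the tuple [map (s x) c] to
   which [c] is moved in the chosen representative *)
pose cls x := [set N | isomorphic (structure_of (f x)) N].
have /choice[rep repP] : forall C : set (structure L), exists M : Str L,
    forall x, C = cls x -> isomorphic (structure_of (f x)) (structure_of M).
  move=> C; have [[x ->]|nC] := pselect (exists x, C = cls x).
    exists (f x) => y xy.
    have : cls x (structure_of (f x)) by exact: isomorphic_refl.
    by rewrite xy.
  by exists (f xpredT) => x Cx; case: nC; exists x.
have /choice[s sP] x :
    exists s, bijective s /\ rep (cls x) = logic_action s (f x).
  have [s bs ->] := isomorphic_logic_action (repP _ _ (erefl (cls x))).
  by exists s.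
have [|h [hI hcls]] :=
    @countable_to_one_injection _ (seq nat) cls (fun x => map (s x) c).
  move=> x y xy sxy; apply: contrapT => /fsep[_ [B [_ sB] ->]]; apply.
  have [bx fx] := sP x; have [by_ fy] := sP y.
  apply: (iff_trans (iff_sym (sB _ bx c (f x)))).
  apply: iff_trans (sB _ by_ c (f y)).
  by rewrite -fx -fy sxy xy.
have := @inj_card_eq _ _ [set: set nat] h (in2W hI).
rewrite card_eq_sym => /card_eqPle[le1 _]; apply: card_le_trans le1 _.
apply: subset_card_le => _ [X _ <-]; have [x ->] := hcls X.
exists (structure_of (f x)) => //; split; first exact: countableP.
by have [] := fK x.
Qed.
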